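(* Let $G$ be a graph. If every nonempty independent set $I$ of $G$ satisfies $|I|\leq \delta_G(I)-1$, then $G$ has a 2-factor.
   Context: All graphs are simple, finite and undirected. $d_G(v)$ denotes the degree of a vertex $v$ in $G$. For a nonempty independent set $I$ of $G$, $\delta_G(I):=\min\{d_G(v)\mid v\in I\}$ is the minimum degree in $G$ of the vertices contained in $I$. A 2-factor of a graph is a spanning 2-regular subgraph. *)

(* Defs.v *)
From mathcomp Require Import all_boot.

Set Implicit Arguments.
Unset Strict Implicit.
Unset Printing Implicit Defensive.

(* A graph on the finite vertex type T is its adjacency
   relation. *)

Section Graphs.

Variable T : finType.
Implicit Types (G H : rel T) (I : {set T}).

Definition simple_graph G := symmetric G /\ irreflexive G.

Definition neighbors G (v : T) : {set T} := [set w | G v w].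

Definition degree G (v : T) : nat := #|neighbors G v|.

Definition independent G I := {in I &, forall u v, ~~ G u v}.

(* The neutral element #|T| bounds every degree, so for nonempty I this is the
   minimum of the degrees in G of the vertices of I. *)
Definition min_degree G I : nat := \big[minn/#|T|]_(v in I) degree G v.

(* Being a relation on the whole of T, H is automatically spanning. *)
Definition spanning_subgraph H G := simple_graph H /\ subrel H G.

Definition regular (k : nat) H := forall v : T, degree H v = k.

Definition two_factor G H := spanning_subgraph H G /\ regular 2 H.

End Graphs.

(* Main.v *)
Require Import Defs.
From mathcomp Require Import all_boot.
From mathcomp Require Import zify.

Set Implicit Arguments.
Unset Strict Implicit.
Unset Printing Implicit Defensive.

(** Tutte's gadget turns 2-factors into perfect matchings. Give every vertex v
    two copies and one dart (v, w) for each neighbour w; join both copies of v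
    to all darts leaving v, and (v, w) to the opposite dart (w, v). In a perfect
    matching of this graph the two copies of v select two edges at v, and an
    edge is either selected at both ends or has its two darts matched together:
    the selected edges form a 2-factor ([two_factor_of_matching]).

    If the gadget has no perfect matching, the Tutte-Berge theorem
    ([tutte_berge]) gives a barrier: a set X of gadget vertices whose removal
    leaves at least |X| + 2 odd components. For an inclusion-minimal X every
    nonempty Y inside X is adjacent to at least |Y| + 2 odd components
    ([min_barrier_expansion]). A dart has only three neighbours and the two
    copies of a vertex have the same neighbours, so X consists of both copies of
    the vertices of a set S and all the darts leaving the vertices of a set R;
    R is independent and disjoint from S, and for t in R the darts (w, t) lie in
    different odd components ([darts_R_inj]).

    Let the weight of a component be its number of darts pointing to R. Apart
    from the isolated copies of the vertices of R, odd components have odd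
    weight, and counting gives |S| + q < |R|, where q is the number of them of
    weight at least 3 ([barrier_count]). Let p be the number of those of weight
    1 that contain the copies of some vertex. A vertex of R has degree at most
    |S| + q + p < |R| + p ([degree_R]).

    If a component of weight 1 contains the copies of a single vertex u, then
    d(u) <= |S| + 1 <= |R|; replacing in R the neighbours of all such vertices
    by these vertices yields an independent set containing u with at least |R|
    elements, against the hypothesis ([no_leaf]). Otherwise each of the p
    components provides a vertex without neighbours in R, and together with R
    these form an independent set of size |R| + p, again too large
    ([no_min_barrier]). *)

(** * Finite sets *)

(* Only the cardinals matter in these goals, and translating the sets of the
   context would take far longer than the arithmetic itself. *)
Ltac card_lia :=
  clear;
  repeat match goal with |- context [@card ?T ?m] => generalize (@card T m) end;
  intros; lia.

Section SetLemmas.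
Variable V : finType.
Implicit Types (A : {set V}) (x y : V).

Lemma cardsD2 A x y : x \in A -> y \in A -> x != y ->
  #|A| = #|A :\: [set x; y]| + 2.
Proof.
move=> xA yA xy; rewrite -(cardsID [set x; y] A) addnC; congr (_ + _).
have /setIidPr -> : [set x; y] \subset A by rewrite subUset !sub1set xA.
by rewrite cards2 xy.
Qed.

Lemma cardsU2 A x y : x \notin A -> y \notin A -> x != y ->
  #|A :|: [set x; y]| = #|A| + 2.
Proof.
move=> xA yA xy; rewrite cardsU cards2 xy.
suff -> : A :&: [set x; y] = set0 by rewrite cards0 subn0.
apply/setP => z; rewrite !inE; apply/negbTE/negP => /andP [zA].
by case/orP=> /eqP zE; rewrite zE (negPf xA, negPf yA) in zA.
Qed.

Lemma even_card_involution A (f : V -> V) :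
    {in A, forall x, [/\ f x \in A, f x != x & f (f x) = x]} ->
  ~~ odd #|A|.
Proof.
have [n] := ubnP #|A|; elim: n A => // n IHn A ltAn fA.
have [->|[x xA]] := set_0Vmem A; first by rewrite cards0.
have [fxA fxN ffx] := fA x xA.
have cA : #|A| = #|A :\: [set x; f x]| + 2 by rewrite -cardsD2 // eq_sym.
rewrite cA oddD addbF IHn //; first by move: ltAn; rewrite cA; card_lia.
move=> y /setDP [yA]; rewrite in_set2 => /norP [yx yfx].
have [fyA fyN ffy] := fA y yA; split=> //; rewrite !inE negb_or fyA andbT.
by apply/andP; split; apply/eqP => E; [case/eqP: yfx | case/eqP: yx];
  rewrite -ffy E ?ffx.
Qed.

End SetLemmas.

(** * Matchings and maximum matchable sets *)

Section Matchings.
Variables (V : finType) (e : rel V).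
Hypotheses (e_sym : symmetric e) (e_irr : irreflexive e).
Implicit Types (A B C W X Y : {set V}) (x y z : V).

Lemma edge_neq x y : e x y -> x != y.
Proof. by apply: contraTneq => ->; rewrite e_irr. Qed.

(** A matching is represented by the involution that exchanges partners, and
    most arguments only use the set of vertices that it covers. *)
Definition matchable A :=
  [exists f : {ffun V -> V}, [forall x in A,
     [&& f x \in A, e x (f x) & f (f x) == x]]].

Lemma matchableP A :
  reflect (exists f : V -> V,
             {in A, forall x, [/\ f x \in A, e x (f x) & f (f x) = x]})
          (matchable A).
Proof.
apply: (iffP existsP) => [[f /forall_inP fA]|[f fA]].
  by exists f => x /fA /and3P [? ? /eqP ?].
exists (finfun f); apply/forall_inP => x /fA [? ? ?].
by rewrite !ffunE; apply/and3P; split=> //; apply/eqP.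
Qed.

Lemma matchable0 : matchable set0.
Proof. by apply/matchableP; exists id => x; rewrite inE. Qed.

Lemma matchable_even A : matchable A -> ~~ odd #|A|.
Proof.
case/matchableP => f fA; apply: (even_card_involution (f := f)) => x /fA [? exf ?].
by split=> //; rewrite eq_sym edge_neq.
Qed.

Lemma matchableU2 A x y : matchable A -> x \notin A -> y \notin A -> e x y ->
  matchable (A :|: [set x; y]).
Proof.
case/matchableP => f fA xA yA exy; have xy := edge_neq exy.
apply/matchableP; exists (fun z => if z == x then y else if z == y then x else f z).
move=> z; rewrite !inE => /orP [zA|/orP [] /eqP ->]; last 2 first.
- by rewrite !eqxx exy (eq_sym y) (negPf xy) orbT /= orbT.
- by rewrite !eqxx (eq_sym y) (negPf xy) !eqxx e_sym exy orbT.
have [fzA ez ffz] := fA z zA.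
have nx w : w \in A -> (w == x) = false.
  by move=> wA; apply: contraNF xA => /eqP <-.
have ny w : w \in A -> (w == y) = false.
  by move=> wA; apply: contraNF yA => /eqP <-.
by rewrite (nx z) // (ny z) // (nx (f z)) // (ny (f z)) // fzA.
Qed.

Lemma matchableD2 A x : matchable A -> x \in A ->
  exists y, [/\ y \in A, e x y & matchable (A :\: [set x; y])].
Proof.
case/matchableP => f fA xA; have [fxA ex ffx] := fA x xA.
exists (f x); split=> //; apply/matchableP; exists f => y /setDP [yA].
rewrite in_set2 => /norP [yx yfx].
have [fyA ey ffy] := fA y yA; split=> //; rewrite !inE negb_or fyA andbT.
by apply/andP; split; apply/eqP => E; [case/eqP: yfx | case/eqP: yx];
  rewrite -ffy E ?ffx.
Qed.

Definition maximum W A :=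
  [/\ A \subset W, matchable A &
      forall B, B \subset W -> matchable B -> #|B| <= #|A|].

Lemma maximum_exists W : exists A, maximum W A.
Proof.
have P0 : (set0 \subset W) && matchable set0 by rewrite sub0set matchable0.
case: (@arg_maxnP _ set0 (fun A => (A \subset W) && matchable A)
  (fun A => #|A|) P0) => A /andP [AW mA] maxA.
by exists A; split=> // B BW mB; apply: maxA; rewrite BW.
Qed.

Lemma maximum_card W A B : maximum W A -> maximum W B -> #|A| = #|B|.
Proof.
move=> [AW mA maxA] [BW mB maxB]; apply/eqP.
by rewrite eqn_leq maxA // maxB.
Qed.

Lemma eq_card_maximum W A B : maximum W A -> B \subset W -> matchable B ->
  #|A| <= #|B| -> maximum W B.
Proof.
move=> [_ _ maxA] BW mB AB; split=> // C CW mC.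
exact: leq_trans (maxA C CW mC) AB.
Qed.

Lemma maximum_meets_edge W A x y : maximum W A -> x \in W -> y \in W ->
  e x y -> (x \in A) || (y \in A).
Proof.
move=> [AW mA maxA] xW yW exy; apply: contraT; rewrite negb_or => /andP [xA yA].
have := maxA (A :|: [set x; y]) _ (matchableU2 mA xA yA exy).
rewrite !subUset !sub1set AW xW yW cardsU2 ?edge_neq //.
by move/(_ isT); card_lia.
Qed.

Lemma maximum_remove_edge W A x y : maximum W A -> x \in A -> y \in A ->
  e x y -> matchable (A :\: [set x; y]) ->
  maximum (W :\: [set x; y]) (A :\: [set x; y]).
Proof.
move=> [AW mA maxA] xA yA exy mA'; split=> //; first exact: setSD.
move=> B; rewrite subsetD => /andP [BW dB] mB.
have xB : x \notin B.
  by apply: contraL dB => xB; apply/pred0Pn; exists x; rewrite !inE xB eqxx.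
have yB : y \notin B.
  by apply: contraL dB => yB; apply/pred0Pn; exists y; rewrite !inE yB eqxx orbT.
have := maxA (B :|: [set x; y]) _ (matchableU2 mB xB yB exy).
rewrite !subUset !sub1set BW !(subsetP AW) // cardsU2 ?edge_neq //.
by move/(_ isT); rewrite (cardsD2 xA yA) ?edge_neq //; card_lia.
Qed.

(** This is the basis exchange property of the matching matroid: as A' and A
    have the same size, at most one vertex missed by A is covered by A'. The
    usual argument follows an alternating path from w; here its first two edges
    w w1 (used by A) and w1 w2 (used by B) are peeled off, and the induction
    continues from w2 in W minus w and w1. *)
Lemma maximum_exchange W A B w : maximum W A -> maximum W B ->
    w \in W -> w \notin B ->
  exists A' z, [/\ maximum W A', w \notin A' & A' \subset z |: A].
Proof.
have [n] := ubnP #|W|; elim: n W A B w => // n IHn W A B w ltWn mA mB wW wB.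
have [wA|wA] := boolP (w \in A); last by exists A, w; rewrite subsetUr.
have [AW matA _] := mA; have [BW matB _] := mB.
have [w1 [w1A ew1 matA1]] := matchableD2 matA wA.
have w1W : w1 \in W := subsetP AW _ w1A.
have w1B : w1 \in B.
  by have := maximum_meets_edge mB wW w1W ew1; rewrite (negPf wB).
have [w2 [w2B ew2 matB1]] := matchableD2 matB w1B.
have w2w : w2 != w by apply: contraNneq wB => <-.
have w2w1 : w2 != w1 by rewrite eq_sym edge_neq.
have w1w : w1 != w by rewrite eq_sym edge_neq.
have w2W : w2 \in W := subsetP BW _ w2B.
have mA1 := maximum_remove_edge mA wA w1A ew1 matA1.
have cA := cardsD2 wA w1A (edge_neq ew1).
set W1 := W :\: [set w; w1] in mA1; set A1 := A :\: [set w; w1] in mA1 cA matA1.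
(* Rematching w1 with w2 instead of w turns a set of W1 avoiding w2 into a
   set of W avoiding w. *)
have lift A2 z : maximum W1 A2 -> w2 \notin A2 -> A2 :|: [set w1; w2] \subset z |: A ->
    exists A' z, [/\ maximum W A', w \notin A' & A' \subset z |: A].
  move=> mA2 w2A2 sub; have [A2W matA2 _] := mA2.
  have nA2 x : x \in [set w; w1] -> x \notin A2.
    by move=> xw; apply: contraL xw => /(subsetP A2W); rewrite inE => /andP [].
  have w1A2 : w1 \notin A2 by rewrite nA2 // !inE eqxx orbT.
  exists (A2 :|: [set w1; w2]), z; split=> //.
    apply: (eq_card_maximum mA); last 1 first.
    - by rewrite cA cardsU2 ?(eq_sym w1) // (maximum_card mA1 mA2).
    - rewrite !subUset !sub1set w1W w2W !andbT.
      exact: subset_trans A2W (subsetDl _ _).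
    - exact: matchableU2.
  by rewrite !inE !negb_or nA2 ?inE ?eqxx // !(eq_sym w) w1w.
have [w2A|w2A] := boolP (w2 \in A); last first.
  apply: (lift A1 w2) => //; first by rewrite !inE (negPf w2A) andbF.
  rewrite !subUset !sub1set !inE w1A eqxx orbT /= andbT.
  exact: subset_trans (subsetDl _ _) (subsetUr _ _).
have mB1 : maximum W1 (B :\: [set w1; w2]).
  apply: (eq_card_maximum mA1) => //.
    apply/subsetP => x; rewrite !inE !negb_or => /andP [/andP [xw1 xw2] xB].
    rewrite xw1 (subsetP BW) // !andbT.
    by apply: contraNneq wB => <-.
  have := cardsD2 w1B w2B (edge_neq ew2).
  by rewrite -(maximum_card mA mB) cA => /eqP; rewrite eqn_add2r => /eqP ->.
have w2W1 : w2 \in W1 by rewrite !inE negb_or w2w w2w1.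
have ltW1 : #|W1| < n.
  by rewrite -ltnS (leq_trans _ ltWn) // (cardsD2 wW w1W (edge_neq ew1)) addn2.
have w2B1 : w2 \notin B :\: [set w1; w2] by rewrite !inE eqxx orbT.
have [A2 [z [mA2 w2A2 sub]]] := IHn W1 A1 _ w2 ltW1 mA1 mB1 w2W1 w2B1.
apply: (lift A2 z) => //; rewrite !subUset !sub1set !inE w1A w2A !orbT !andbT.
by apply: subset_trans sub (setUS _ (subsetDl _ _)).
Qed.

(** * Components and the Tutte-Berge theorem *)

Definition edge_in W := [rel x y | [&& x \in W, y \in W & e x y]].

(** The component is empty when x is outside W, so that a nonempty component
    certifies that x is in W. *)
Definition comp W x := [set y | (x \in W) && connect (edge_in W) x y].

Definition odd_comps W := [set comp W x | x in V & odd #|comp W x|].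

Lemma edge_in_sym W : symmetric (edge_in W).
Proof. by move=> x y; rewrite /= e_sym andbCA. Qed.

Lemma connect_edge_in_sym W : connect_sym (edge_in W).
Proof. exact: sym_connect_sym (@edge_in_sym W). Qed.

Lemma comp_out W x : x \notin W -> comp W x = set0.
Proof. by move=> xW; apply/setP => y; rewrite !inE (negPf xW). Qed.

Lemma comp_refl W x : x \in W -> x \in comp W x.
Proof. by move=> xW; rewrite inE xW connect0. Qed.

Lemma comp_ind W (P : V -> Prop) x : P x ->
    (forall y z, y \in W -> z \in W -> e y z -> P y -> P z) ->
  forall y, y \in comp W x -> P y.
Proof.
move=> Px stepP y; rewrite inE => /andP [_ /connectP [p]].
elim: p x Px => [|z p IHp] x Px /=; first by move=> _ ->.
by case/andP => /and3P [xW zW exz]; apply: IHp; apply: stepP exz Px.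
Qed.

Lemma comp_closed W A x : x \in A ->
  {in A & W, forall y z, y \in W -> e y z -> z \in A} -> comp W x \subset A.
Proof.
move=> xA clA; apply/subsetP; apply: comp_ind => // y z yW zW eyz yA.
exact: clA yA zW yW eyz.
Qed.

Lemma comp_sub W x : comp W x \subset W.
Proof.
have [xW|xW] := boolP (x \in W); last by rewrite comp_out ?sub0set.
exact: comp_closed.
Qed.

Lemma comp_eq W x y : y \in comp W x -> comp W y = comp W x.
Proof.
move=> yx; have yW := subsetP (comp_sub W x) _ yx.
move: yx; rewrite inE => /andP [xW cxy].
apply/setP => z; rewrite !inE xW yW /=.
exact/esym/(same_connect (@connect_edge_in_sym W) cxy).
Qed.

Lemma comp_edge W x y : x \in W -> y \in W -> e x y -> comp W y = comp W x.
Proof.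
by move=> xW yW exy; apply: comp_eq; rewrite inE xW connect1 //= xW yW.
Qed.

Lemma comp_edge_mem W C x y : C \in odd_comps W -> x \in C -> y \in W ->
  e x y -> y \in C.
Proof.
case/imsetP => z _ -> xz yW exy; have xW := subsetP (comp_sub W z) _ xz.
by rewrite -(comp_eq xz) -(comp_edge xW yW exy) comp_refl.
Qed.

Lemma odd_comps_mem W x : (comp W x \in odd_comps W) = odd #|comp W x|.
Proof.
apply/imsetP/idP => [[y]|ox]; last by exists x; rewrite ?inE.
by rewrite inE => /andP [_ oy] ->.
Qed.

Lemma odd_comps_eq W C x : C \in odd_comps W -> x \in C -> C = comp W x.
Proof. by case/imsetP => y _ -> /comp_eq ->. Qed.

Lemma odd_comps_sub W C : C \in odd_comps W -> C \subset W.
Proof. by case/imsetP => y _ ->; apply: comp_sub. Qed.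

Lemma odd_comps_odd W C : C \in odd_comps W -> odd #|C|.
Proof. by case/imsetP => y; rewrite inE => /andP [_ oy] ->. Qed.

(** Gallai's lemma. The relation between x and y saying that they are equal or
    never missed together contains the edges, and it is transitive through any u
    that some maximum set misses: were A to miss x and v, exchange would give a
    maximum set missing u and still missing x or v. *)
Lemma gallai W A x y :
    (forall w, w \in W -> exists2 B, maximum W B & w \notin B) ->
    maximum W A -> y \in comp W x -> x \notin A -> y \notin A -> x = y.
Proof.
move=> missed mA yx xA yA.
pose K u := x = u \/ forall A, maximum W A -> (x \in A) || (u \in A).
suff [//|/(_ A mA)] : K y by rewrite (negPf xA) (negPf yA).
apply: (comp_ind (P := K)) yx => [|u v uW vW euv Ku]; first by left.
rewrite /K; have [->|xv] := eqVneq x v; [by left | right=> A0 mA0].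
apply: contraT; rewrite negb_or => /andP [xA0 vA0].
case: Ku => [xu|Hxu].
  by have := maximum_meets_edge mA0 uW vW euv; rewrite -xu (negPf xA0) (negPf vA0).
have [B mB uB] := missed u uW.
have [A' [z [mA' uA' sub]]] := maximum_exchange mA0 mB uW uB.
have xA' : x \in A' by have := Hxu _ mA'; rewrite (negPf uA') orbF.
have vA' : v \in A' by have := maximum_meets_edge mA' uW vW euv; rewrite (negPf uA').
move: (subsetP sub _ xA') (subsetP sub _ vA').
rewrite !inE (negPf xA0) (negPf vA0) !orbF => /eqP xz /eqP vz.
by rewrite xz vz eqxx in xv.
Qed.

Lemma matchable_comp W A x : A \subset W -> matchable A ->
  matchable (A :&: comp W x).
Proof.
move=> AW /matchableP [f fA]; apply/matchableP; exists f => y.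
rewrite in_setI => /andP [yA yx]; have [fyA ey ffy] := fA y yA; split=> //.
have fyW := subsetP AW _ fyA.
rewrite in_setI fyA -(comp_eq yx) -(comp_edge (subsetP AW _ yA) fyW ey).
exact: comp_refl.
Qed.

(** Induction on |W|. A vertex w covered by all the maximum sets is put into X:
    deleting it lowers the maximum by 2. If there is no such vertex, the empty
    X works, since by Gallai's lemma the vertices missed by A lie in different
    components, and each of these components is odd. *)
Lemma tutte_berge W A : maximum W A ->
  exists2 X : {set V}, X \subset W & #|X| + #|W| <= #|odd_comps (W :\: X)| + #|A|.
Proof.
have [n] := ubnP #|W|; elim: n W A => // n IHn W A ltWn mA.
have [/forall_inP allmiss | ] := boolP [forall w in W,
  [exists B : {set V}, [&& B \subset W, matchable B, #|A| <= #|B| & w \notin B]]].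
  have missed w : w \in W -> exists2 B, maximum W B & w \notin B.
    move/allmiss/existsP => [B /and4P [BW mB cB wB]].
    by exists B => //; apply: eq_card_maximum mA _ _ _.
  have [AW matA _] := mA.
  exists set0; first exact: sub0set.
  rewrite cards0 setD0 add0n -(cardsID A W) (setIidPr AW) addnC leq_add2r.
  have inj : {in W :\: A &, injective (comp W)}.
    move=> x y; rewrite !inE => /andP [xA xW] /andP [yA yW] E.
    by apply: (gallai missed mA) => //; rewrite E comp_refl.
  rewrite -(card_in_imset inj); apply/subset_leq_card/subsetP => C.
  case/imsetP => x; rewrite !inE => /andP [xA xW] ->.
  rewrite odd_comps_mem (cardsD1 x) comp_refl //=.
  suff -> : comp W x :\ x = A :&: comp W x by apply/matchable_even/matchable_comp.
  apply/setP => y; rewrite in_setD1 in_setI.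
  have [yx|] := boolP (y \in comp W x); rewrite ?andbF // !andbT.
  have [->|yNx] := eqVneq y x; first by rewrite (negPf xA).
  apply/esym; apply: contraNT yNx => yA.
  by apply/eqP/esym/(gallai missed mA).
rewrite negb_forall_in => /existsP [w /andP [wW]].
rewrite negb_exists => /forallP nB.
have [B mB] := maximum_exists (W :\ w); have [BW matB _] := mB.
have ltW1 : #|W :\ w| < n by move: ltWn; rewrite (cardsD1 w) wW; card_lia.
have [X XW leX] := IHn _ _ ltW1 mB.
have wB : w \notin B by apply/negP => /(subsetP BW); rewrite !inE eqxx.
have wX : w \notin X by apply/negP => /(subsetP XW); rewrite !inE eqxx.
have ltBA : #|B| < #|A|.
  have := nB B; rewrite matB wB (subset_trans BW (subsetDl _ _)) andbT /=.
  by rewrite -ltnNge.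
exists (w |: X).
  by rewrite subUset sub1set wW (subset_trans XW (subsetDl _ _)).
have -> : W :\: (w |: X) = (W :\ w) :\: X by rewrite setDDl.
have oA := matchable_even (let: And3 _ m _ := mA in m).
have oB := matchable_even matB.
move: leX ltBA oA oB; rewrite cardsU1 wX (cardsD1 w W) wW; card_lia.
Qed.

(** * Minimal barriers *)

Lemma odd_comps_parity W : odd #|odd_comps W| = odd #|W|.
Proof.
pose P := comp W @: W.
have PE C x : C \in P -> x \in C -> C = comp W x.
  by case/imsetP => y _ -> /comp_eq ->.
have partP : partition P W.
  apply/and3P; split.
  - rewrite eqEsubset; apply/andP; split.
      by apply/bigcupsP => C /imsetP [x _ ->]; apply: comp_sub.
    apply/subsetP => x xW; apply/bigcupP; exists (comp W x); last exact: comp_refl.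
    exact: imset_f.
  - apply/trivIsetP => C D CP DP; apply: contraNT => /pred0Pn [x /andP [xC xD]].
    by rewrite (PE _ _ CP xC) (PE _ _ DP xD).
  - by apply/imsetP => -[x xW E]; have := comp_refl xW; rewrite -E inE.
rewrite (card_partition partP).
have -> : odd_comps W = [set C in P | odd #|C|].
  apply/setP => C; rewrite [RHS]inE; apply/idP/andP => [CO|[/imsetP [x xW ->]]].
    have oC := odd_comps_odd CO; split=> //; case/imsetP: CO oC => x _ -> oC.
    by apply: imset_f; apply: contraLR oC => /comp_out ->; rewrite cards0.
  by rewrite odd_comps_mem.
rewrite -sum1_card [RHS](big_morph _ oddD (erefl _ : odd 0 = false)).
rewrite (big_morph _ oddD (erefl _ : odd 0 = false)).
rewrite big_mkcond [RHS]big_mkcond /=; apply: eq_bigr => C _; rewrite inE.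
by case: (C \in P) => //=; case: (odd _).
Qed.

Lemma comp_extend W W' x : x \in W -> W \subset W' ->
    {in comp W x & W', forall y z, e y z -> z \in W} ->
  comp W' x = comp W x.
Proof.
move=> xW sW out; apply/eqP; rewrite eqEsubset; apply/andP; split.
  apply: comp_closed => [|y z yC zW' _ eyz]; first exact: comp_refl.
  have zW := out y z yC zW' eyz; rewrite -(comp_eq yC).
  by rewrite -(comp_edge (subsetP (comp_sub W x) _ yC) zW eyz) comp_refl.
apply: comp_closed => [|y z yC zW yW eyz]; first exact/comp_refl/(subsetP sW).
rewrite -(comp_eq yC) -(comp_edge _ _ eyz) ?(subsetP sW) //.
exact/comp_refl/(subsetP sW).
Qed.

(** The margin 2, rather than 1, comes for free when |W| is even, by parity. *)
Definition barrier W X := (X \subset W) && (#|X| + 2 <= #|odd_comps (W :\: X)|).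

Lemma min_barrier_exists W : ~~ matchable W -> ~~ odd #|W| ->
  exists X, minset (barrier W) X.
Proof.
move=> nW oW; have [A mA] := maximum_exists W; have [AW matA _] := mA.
have [X XW leX] := tutte_berge mA.
have bX : barrier W X.
  have ltAW : #|A| < #|W|.
    rewrite ltnNge; apply: contra nW => leWA.
    by have /eqP <- : A == W by rewrite eqEcard AW.
  have oA := matchable_even matA; rewrite /barrier XW; move: leX ltAW oA oW; card_lia.
by have [Y minY _] := minset_exists bX; exists Y.
Qed.

(** Here K is any collection containing the components adjacent to Y. Putting Y
    back only alters these, so if at most |Y| + 1 of them were odd, X minus Y
    would leave an excess of at least 1 odd component; parity makes it 2, and
    X minus Y would be a smaller barrier. *)
Lemma min_barrier_expansion W X Y (K : {set {set V}}) :
    ~~ odd #|W| -> minset (barrier W) X -> Y \subset X -> Y != set0 ->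
    {in Y & W :\: X, forall y z, e y z -> comp (W :\: X) z \in K} ->
  #|Y| + 2 <= #|K :&: odd_comps (W :\: X)|.
Proof.
move=> oW /minsetP [/andP [XW bX] minX] YX Y0 KP.
set O := odd_comps _ in bX *.
have sub : O :\: K \subset odd_comps (W :\: (X :\: Y)).
  apply/subsetP => C /setDP [CO CK].
  have [x xC] : exists x, x \in C.
    by apply/set0Pn; apply: contraTneq (odd_comps_odd CO) => ->; rewrite cards0.
  have xW := subsetP (odd_comps_sub CO) _ xC.
  have sW : W :\: X \subset W :\: (X :\: Y) by apply: setDS; apply: subsetDl.
  have EC := odd_comps_eq CO xC; have oC := odd_comps_odd CO.
  suff E : comp (W :\: (X :\: Y)) x = comp (W :\: X) x.
    by rewrite EC -E odd_comps_mem E -EC.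
  apply: comp_extend => // y z; rewrite -EC => yC zW eyz.
  move: zW; rewrite !inE negb_and negbK => /andP [/orP [zY|zX] zW]; last by rewrite zX.
  have yW := subsetP (odd_comps_sub CO) _ yC.
  case/negP: CK; rewrite (odd_comps_eq CO yC).
  by apply: (KP z y); rewrite // e_sym.
have leO : #|O| <= #|odd_comps (W :\: (X :\: Y))| + #|K :&: O|.
  by rewrite -(cardsID K O) addnC setIC leq_add2r subset_leq_card.
have cX : #|X| = #|X :\: Y| + #|Y| by rewrite -(cardsID Y X) (setIidPr YX) addnC.
have cW : #|W| = #|W :\: (X :\: Y)| + #|X :\: Y|.
  have dXW := subset_trans (subsetDl X Y) XW.
  by rewrite -(cardsID (X :\: Y) W) (setIidPr dXW) addnC.
have := odd_comps_parity (W :\: (X :\: Y)); move Ep: #|odd_comps _| leO => p leO pW.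
have lep : p <= #|X :\: Y| + 1.
  rewrite leqNgt; apply/negP => ltp.
  have bY : barrier W (X :\: Y).
    by rewrite /barrier (subset_trans (subsetDl _ _) XW) Ep; move: bX cX ltp; card_lia.
  have E := minX _ bY (subsetDl _ _).
  by move: Y0; rewrite -card_gt0; move: cX; rewrite E; card_lia.
have : odd #|W| = odd #|W :\: (X :\: Y)| (+) odd #|X :\: Y| by rewrite cW oddD.
rewrite (negPf oW) -pW => par.
by move: leO lep cX bX par; card_lia.
Qed.

End Matchings.

(** * The gadget graph *)

Section Gadget.
Variables (T : finType) (G : rel T).
Hypotheses (G_sym : symmetric G) (G_irr : irreflexive G).
Implicit Types (u v w t : T) (b : bool).

(** All pairs occur as darts here; the gadget proper is the graph induced on the
    set [gvalid] below, whose darts are the oriented edges of G. *)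
Definition gvertex : finType := (T * bool + T * T)%type.

Definition copy v b : gvertex := inl (v, b).
Definition dart u v : gvertex := inr (u, v).

Definition gedge (x y : gvertex) : bool :=
  match x, y with
  | inl p, inr d => (p.1 == d.1) && G d.1 d.2
  | inr d, inl p => (p.1 == d.1) && G d.1 d.2
  | inr d, inr d' => (d' == (d.2, d.1)) && G d.1 d.2
  | inl _, inl _ => false
  end.

Definition gvalid : {set gvertex} :=
  [set x : gvertex | if x is inr d then G d.1 d.2 else true].

(** This fixed-point-free involution, exchanging the copies of a vertex and
    reversing darts, serves to compute parities. *)
Definition flip (x : gvertex) : gvertex :=
  match x with inl p => copy p.1 (~~ p.2) | inr d => dart d.2 d.1 end.

Lemma flipK : involutive flip.
Proof. by case=> -[u v] //=; rewrite /copy negbK. Qed.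

Lemma gedge_sym : symmetric gedge.
Proof.
move=> [[u b]|[u v]] [[u' b']|[u' v']] //=; rewrite !xpair_eqE.
by apply/andP/andP => -[/andP [/eqP -> /eqP ->]]; rewrite !eqxx G_sym.
Qed.

Lemma gedge_irr : irreflexive gedge.
Proof.
move=> [[u b]|[u v]] //=; rewrite xpair_eqE.
by apply/negP => /andP [/andP [/eqP -> _]]; rewrite G_irr.
Qed.

Lemma gedge_copy_dart v b u w : gedge (copy v b) (dart u w) = (v == u) && G u w.
Proof. by []. Qed.

Lemma gedge_dart u w : gedge (dart u w) (dart w u) = G u w.
Proof. by rewrite /= eqxx. Qed.

Lemma copy_valid v b : copy v b \in gvalid.
Proof. by rewrite inE. Qed.

Lemma dart_valid u w : (dart u w \in gvalid) = G u w.
Proof. by rewrite inE. Qed.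

Lemma flip_neq x : x \in gvalid -> flip x != x.
Proof.
case: x => [[v b]|[u w]]; rewrite !inE /=; first by case: b => _; apply/eqP => -[].
by apply: contraTneq => -[->]; rewrite G_irr.
Qed.

Lemma flip_valid x : x \in gvalid -> flip x \in gvalid.
Proof. by case: x => [[v b]|[u w]]; rewrite !inE //= G_sym. Qed.

Lemma gvalid_even : ~~ odd #|gvalid|.
Proof.
apply: (even_card_involution (f := flip)) => x xV.
by split; [exact: flip_valid | exact: flip_neq | exact: flipK].
Qed.

Lemma two_factor_of_matching :
  matchable gedge gvalid -> exists H : rel T, two_factor G H.
Proof.
case/matchableP => f fV.
have fcopy v b : exists2 w, f (copy v b) = dart v w & G v w.
  have [_ ] := fV _ (copy_valid v b).
  case: (f _) => [[u b']|[u w]] //=; case/andP => /eqP /= <- Gvw _.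
  by exists w.
pose H := [rel u w | G u w && (f (dart u w) != dart w u)].
exists H; split; last first.
  move=> v; rewrite /degree.
  have [w0 f0 G0] := fcopy v true; have [w1 f1 G1] := fcopy v false.
  have [_ _ ff0] := fV _ (copy_valid v true).
  have [_ _ ff1] := fV _ (copy_valid v false).
  have w01 : w0 != w1.
    by apply/eqP => E; move: ff1; rewrite f1 -E -f0 ff0.
  suff -> : neighbors H v = [set w0; w1] by rewrite cards2 w01.
  apply/setP => w; rewrite !inE /=; apply/idP/orP => [/andP [Gvw]|].
    have := fV (dart v w); rewrite dart_valid => /(_ Gvw) [_ + ffw].
    case E : (f (dart v w)) => [[u b]|[u' w']] /=.
      case/andP => /eqP /= uv _ _; rewrite uv in E.
      by move: ffw; rewrite E; case: b {E} => E; [left; move: f0 | right; move: f1];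
        rewrite E => -[->].
    by case/andP => /eqP -> _; rewrite eqxx.
  by case=> /eqP ->; rewrite ?G0 ?G1 /=; [rewrite -f0 ff0 | rewrite -f1 ff1].
split; last by move=> u w /andP [].
split=> [u w|u] /=; last by rewrite G_irr.
rewrite G_sym; case Guw : (G w u) => //=; congr (~~ _).
have [_ _ ffu] := fV (dart u w) (etrans (dart_valid u w) (etrans (G_sym u w) Guw)).
have [_ _ ffw] := fV (dart w u) (etrans (dart_valid w u) Guw).
by apply/eqP/eqP => E; [rewrite -E ffu | rewrite -E ffw].
Qed.

(** * The shape of a minimal barrier of the gadget *)

Section MinBarrier.
Variable X : {set gvertex}.
Hypothesis minX : minset (barrier gedge gvalid) X.

Let W := gvalid :\: X.
Let cmp := comp gedge W.
Let O := odd_comps gedge W.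
Let S := [set v | copy v true \in X].
Let R := [set t | [exists w, dart t w \in X]].

Let expansion Y K := min_barrier_expansion gedge_sym gvalid_even (Y := Y) (K := K) minX.

Let cmp_sym := comp_eq gedge_sym.

Lemma X_valid x : x \in X -> x \in gvalid.
Proof. by case/minsetP: minX => /andP [/subsetP XV _] _; apply: XV. Qed.

Lemma in_free x : (x \in W) = (x \notin X) && (x \in gvalid).
Proof. by rewrite in_setD. Qed.

Lemma odd_free x : cmp x \in O -> x \in W.
Proof.
by rewrite odd_comps_mem; apply: contraLR => xW; rewrite /cmp comp_out ?cards0.
Qed.

(** A dart in X is adjacent to three odd components and has just three neighbours,
    which therefore all lie outside X, in different odd components. *)
Lemma dart_barrier u w : dart u w \in X ->
  [/\ forall b, cmp (copy u b) \in O, cmp (copy u true) != cmp (copy u false)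
    & cmp (dart w u) \in O].
Proof.
move=> uX; pose K := [set cmp (copy u true); cmp (copy u false)] :|: [set cmp (dart w u)].
have := @expansion [set dart u w] K; rewrite cards1 sub1set uX.
have -> : [set dart u w] != set0 by apply/set0Pn; exists (dart u w); rewrite inE.
have KP : {in [set dart u w] & W, forall y z, gedge y z -> comp gedge W z \in K}.
  move=> _ z /set1P -> _; case: z => [[v b]|[v v']] /=; case/andP => /eqP /= -> _.
    by case: b; rewrite !inE eqxx ?orbT.
  by rewrite !inE eqxx ?orbT.
move/(_ isT isT KP) => leK.
have KI : K :&: O = K.
  apply/eqP; rewrite eqEcard subsetIl; apply: leq_trans leK.
  rewrite /K setUC; apply: leq_trans (leq_card_setU _ _) _.
  by rewrite cards1 cards2; case: eqP.
have KO C : C \in K -> C \in O by rewrite -KI inE => /andP [].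
split.
- by case; apply: KO; rewrite !inE eqxx ?orbT.
- move: leK; rewrite KI /K; apply: contraTneq => ->.
  by rewrite setUid -ltnNge cards2; case: eqP.
- by apply: KO; rewrite !inE eqxx ?orbT.
Qed.

(** Otherwise the dart (t, w') would connect the two copies of t, which
    [dart_barrier] separates. *)
Lemma darts_barrier t w w' : dart t w \in X -> G t w' -> dart t w' \in X.
Proof.
move=> tX Gtw; have [cO neq _] := dart_barrier tX.
apply: contraT => tNX; case/eqP: neq.
have dW : dart t w' \in W by rewrite in_free tNX dart_valid.
have E b : cmp (dart t w') = cmp (copy t b).
  apply: (comp_edge gedge_sym) => //; last by rewrite gedge_copy_dart eqxx.
  exact: odd_free.
by rewrite -!E.
Qed.

Lemma darts_R t w : t \in R -> G t w -> dart t w \in X.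
Proof. by rewrite inE => /existsP [w0]; apply: darts_barrier. Qed.

Lemma dart_in_R t w : dart t w \in X -> t \in R.
Proof. by move=> tX; rewrite inE; apply/existsP; exists w. Qed.

(** If the other copy were outside X, it would be adjacent to all the neighbours
    of this one that are outside X, and a single component would be reached. *)
Lemma copies_barrier v b : copy v b \in X -> copy v (~~ b) \in X.
Proof.
move=> vX; apply: contraT => vNX.
have := @expansion [set copy v b] [set cmp (copy v (~~ b))]; rewrite cards1 sub1set vX.
have -> : [set copy v b] != set0 by apply/set0Pn; exists (copy v b); rewrite inE.
have KP : {in [set copy v b] & W, forall y z, gedge y z ->
    comp gedge W z \in [set cmp (copy v (~~ b))]}.
  move=> _ z /set1P -> zW; case: z zW => [//|[u w]].
  rewrite -/(dart u w) => uW; rewrite gedge_copy_dart => /andP [/eqP vu Gvw].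
  subst u; rewrite inE; apply/eqP.
  apply: (comp_edge gedge_sym) => //; first by rewrite in_free vNX copy_valid.
  by rewrite gedge_copy_dart eqxx.
move/(_ isT isT KP); rewrite leqNgt.
rewrite (leq_ltn_trans (subset_leq_card (subsetIl _ _))) // cards1 //.
Qed.

Lemma copies_S v b : (copy v b \in X) = (v \in S).
Proof.
rewrite inE; case: b => //.
by apply/idP/idP => /copies_barrier.
Qed.

Lemma copy_free v b : v \notin S -> copy v b \in W.
Proof. by rewrite in_free copies_S copy_valid => ->. Qed.

Lemma dart_free u w : G u w -> u \notin R -> dart u w \in W.
Proof.
by move=> Guw uR; rewrite in_free dart_valid Guw andbT; apply: contra uR => /dart_in_R.
Qed.

Lemma R_not_S t : t \in R -> t \notin S.
Proof.
rewrite inE => /existsP [w /dart_barrier [/(_ true)/odd_free + _ _]].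
by rewrite in_free copies_S => /andP [].
Qed.

Lemma R_independent : {in R &, forall t t', ~~ G t t'}.
Proof.
move=> t t' tR t'R; apply/negP => Gtt.
have [_ _ /odd_free] := dart_barrier (darts_R tR Gtt).
by rewrite in_free (darts_R t'R) // G_sym.
Qed.

Lemma cmp_copy_R t b : t \in R -> cmp (copy t b) = [set copy t b].
Proof.
move=> tR; apply/eqP; rewrite eqEsubset sub1set comp_refl ?copy_free ?R_not_S // andbT.
apply: comp_closed => [|y z]; first by rewrite inE.
move/set1P ->; case: z => [//|[u w]].
rewrite -/(dart u w) => zW _; rewrite gedge_copy_dart => /andP [/eqP tu Gtw]; subst u.
by move: zW; rewrite in_free (darts_R tR).
Qed.

(** Of the components adjacent to the darts leaving t, at most two are those
    of the copies of t, so the opposite darts must supply one component for each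
    neighbour of t. *)
Lemma darts_R_inj t : t \in R -> {in neighbors G t &, injective (fun w => cmp (dart w t))}.
Proof.
move=> tR; apply/imset_injP; set I := _ @: _; rewrite eqn_leq leq_imset_card /=.
pose Y := [set dart t w | w in neighbors G t].
have cY : #|Y| = #|neighbors G t| by apply: card_imset => w w' [].
have := @expansion Y ([set cmp (copy t true); cmp (copy t false)] :|: I); rewrite -/W cY.
have -> : Y \subset X.
  by apply/subsetP => _ /imsetP [w + ->]; rewrite inE; apply: darts_R.
have -> : Y != set0.
  move: tR; rewrite inE => /existsP [w tX]; apply/set0Pn; exists (dart t w).
  by apply: imset_f; rewrite inE -dart_valid X_valid.
have KP : {in Y & W, forall y z, gedge y z -> comp gedge W z \in
    [set cmp (copy t true); cmp (copy t false)] :|: I}.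
  move=> _ z /imsetP [w wt ->] zW; case: z zW => [[v b]|[v v']] zW /=.
    by case/andP => /eqP /= -> _; case: b {zW}; rewrite !inE eqxx ?orbT.
  case/andP => /eqP -> _; rewrite in_setU; apply/orP; right.
  by apply/imsetP; exists w.
move/(_ isT isT KP) => /leq_trans /(_ (subset_leq_card (subsetIl _ _))).
move/leq_trans/(_ (leq_card_setU _ _)); rewrite addn2 cards2.
by case: eqP => _ /=; rewrite ?add1n ?add2n !ltnS // => /ltnW.
Qed.

(** * Counting odd components *)

(** The copies of a vertex of R are isolated vertices once X is removed; Q
    consists of the other odd components. *)
Definition Q := [set C in O | [forall t in R, [forall b, copy t b \notin C]]].

(** As X contains the copies of a vertex together, a vertex outside X whose flip
    lies in X is a dart pointing to R: each unit of weight stands for an edge of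
    G that joins R to the component. *)
Definition weight (C : {set gvertex}) := #|C :&: [set x | flip x \in X]|.

Lemma Q_odd C : C \in Q -> C \in O. Proof. by rewrite inE => /andP []. Qed.

Lemma Q_copy C v b : C \in Q -> copy v b \in C -> v \notin R.
Proof.
rewrite inE => /andP [_ /forall_inP CQ] vC; apply/negP => /CQ /forallP /(_ b).
by rewrite vC.
Qed.

Lemma dart_flip_X C x : C \in O -> x \in C -> flip x \in X -> exists d, x = inr d.
Proof.
move=> CO xC fX; have xW := subsetP (odd_comps_sub CO) _ xC.
case: x fX xC xW => [[v b]|d]; last by exists d.
by rewrite /= copies_S => vS _; rewrite in_free copies_S vS.
Qed.

Hypothesis deg_gt0 : forall v, 0 < degree G v.

(** The flip is an involution on the part of C not counted by the weight: the
    copies of a vertex outside R are connected through any dart leaving it. *)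
Lemma weight_odd C : C \in Q -> odd (weight C).
Proof.
move=> CQ; have CO := Q_odd CQ; have := odd_comps_odd CO.
rewrite -(cardsID [set x | flip x \in X] C) oddD -/(weight C).
suff /negPf -> : ~~ odd #|C :\: [set x | flip x \in X]| by rewrite addbF.
apply: (even_card_involution (f := flip)) => x /setDP [xC].
rewrite in_set => fX; have xW := subsetP (odd_comps_sub CO) _ xC.
have /andP [xX xV] : (x \notin X) && (x \in gvalid) by rewrite -in_free.
split; [|exact: flip_neq|exact: flipK].
have fW : flip x \in W by rewrite in_free fX flip_valid.
rewrite in_setD in_set flipK xX /=.
case: x xC xX fX xW xV fW => [[v b]|[u w]] xC xX fX xW xV fW; last first.
  by apply: (comp_edge_mem gedge_sym CO xC) => //=; rewrite eqxx -dart_valid.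
have vR := Q_copy CQ xC.
have [w] : exists w, w \in neighbors G v by apply/card_gt0P/deg_gt0.
rewrite inE => Gvw; have dW := dart_free Gvw vR.
have dC : dart v w \in C.
  by apply: (comp_edge_mem gedge_sym CO xC dW); rewrite gedge_copy_dart eqxx.
by apply: (comp_edge_mem gedge_sym CO dC fW); rewrite /= eqxx.
Qed.

Let Q3 := [set C in Q | weight C != 1].
Let Q1 := [set C in Q | (weight C == 1) && [exists u, copy u true \in C]].

(** There are at least |X| + 2 odd components, of which at most 2|R| are copies
    of vertices of R. In turn |X| is at least 2|S| plus the number of darts in
    X, which bounds the sum of the weights over Q; and this sum is at least
    |Q| + 2|Q3| since the weights are odd. *)
Lemma barrier_count : #|S| + #|Q3| < #|R|.
Proof.
have [/andP [_ bX] _] := minsetP minX.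
pose Xd := X :&: [set x | if x is inr _ then true else false].
have leX : #|S| * 2 + #|Xd| <= #|X|.
  rewrite -(cardsID [set x | if x is inr _ then true else false] X) addnC leq_add2l.
  rewrite -card_bool -cardsT -cardsX -(card_imset _ (@inl_inj _ (T * T)%type)).
  apply/subset_leq_card/subsetP => _ /imsetP [[v b] + ->].
  rewrite in_setX in_setT andbT => vS.
  by rewrite in_setD in_set /= -/(copy v b) copies_S.
have leO : #|O| <= #|R| * 2 + #|Q|.
  rewrite -[2]card_bool -cardsT -cardsX.
  apply: leq_trans (leq_add (leq_imset_card (fun p => cmp (inl p)) _) (leqnn _)).
  apply: leq_trans (leq_card_setU _ _); apply/subset_leq_card/subsetP => C CO.
  rewrite in_setU [C \in Q]inE CO /=.
  have [_|] := boolP [forall t in R, [forall b, copy t b \notin C]]; rewrite ?orbT // orbF.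
  rewrite negb_forall_in => /existsP [t /andP [tR]].
  rewrite negb_forall => /existsP [b]; rewrite negbK => tC.
  apply/imsetP; exists (t, b); first by rewrite in_setX in_setT tR.
  exact: (odd_comps_eq gedge_sym CO tC).
have leQ : \sum_(C in Q) weight C <= #|Xd|.
  have E C : C \in Q -> weight C = \sum_(x in Xd) (flip x \in C).
    move=> CQ; rewrite /weight -sum1_card.
    rewrite (reindex_inj (inv_inj flipK)) big_mkcond [RHS]big_mkcond /=.
    apply: eq_bigr => x _; rewrite !inE flipK.
    have [xX|] := boolP (x \in X); last by rewrite andbF.
    have [xC|//] := boolP (flip x \in C); last by rewrite if_same.
    have [] := dart_flip_X (Q_odd CQ) xC; first by rewrite flipK.
    by case: x xX xC => //= -[].
  rewrite (eq_bigr _ E) exchange_big /= -sum1_card; apply: leq_sum => x _.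
  have [/existsP [C0 /andP [C0Q xC0]]|none] := boolP [exists C in Q, flip x \in C].
    rewrite (bigD1 C0) //= xC0 big1 // => C /andP [CQ CC].
    have [xC|//] := boolP (flip x \in C); case/eqP: CC.
    by rewrite (odd_comps_eq gedge_sym (Q_odd CQ) xC)
      (odd_comps_eq gedge_sym (Q_odd C0Q) xC0).
  rewrite big1 // => C CQ; apply/eqP; rewrite eqb0; apply: contra none => xC.
  by apply/existsP; exists C; rewrite CQ.
have geQ : #|Q| + #|Q3| * 2 <= \sum_(C in Q) weight C.
  have -> : #|Q3| = \sum_(C in Q) (weight C != 1).
    rewrite -sum1_card [LHS]big_mkcond [RHS]big_mkcond /=; apply: eq_bigr => C _.
    by rewrite [C \in Q3]in_set; case: (C \in Q) => //=; case: (_ == _).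
  rewrite -sum1_card big_distrl -big_split /=; apply: leq_sum => C CQ.
  by have := weight_odd CQ; case: (weight C) => [|[|[|]]].
by move: bX leX leO (leq_trans geQ leQ); rewrite -/W -/O; card_lia.
Qed.

(** For each neighbour w of t outside S, the component of the dart (w, t) contains
    the copies of w and belongs to Q; different w give different components. *)
Lemma degree_R t : t \in R -> degree G t <= #|S| + #|Q3| + #|Q1|.
Proof.
move=> tR; rewrite /degree -(cardsID S (neighbors G t)) -addnA.
apply: leq_add; first by rewrite subset_leq_card // subsetIr.
rewrite -(card_in_imset (f := fun w => cmp (dart w t))); last first.
  by move=> w w' /setDP [wt _] /setDP [w't _]; apply: darts_R_inj.
apply: leq_trans (leq_card_setU _ _).
apply/subset_leq_card/subsetP => _ /imsetP [w /setDP [wt wS] ->].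
move: wt; rewrite inE => Gtw; have Gwt : G w t by rewrite G_sym.
have [_ _ dO] := dart_barrier (darts_R tR Gtw).
have wR : w \notin R by apply/negP => /(R_independent tR); rewrite Gtw.
have dW := dart_free Gwt wR.
have dC := comp_refl gedge dW.
have dQ : cmp (dart w t) \in Q.
  rewrite inE dO; apply/forall_inP => t' t'R; apply/forallP => b.
  apply/negP => t'C; have := dC; rewrite -(cmp_sym t'C).
  by rewrite -/cmp cmp_copy_R // inE.
have wC : copy w true \in cmp (dart w t).
  by apply: (comp_edge_mem gedge_sym dO dC) => //=; rewrite ?copy_free // eqxx.
rewrite in_setU [_ \in Q3]in_set [_ \in Q1]in_set dQ /=; case: eqP => //= _.
by apply/existsP; exists w.
Qed.

Lemma neighbors_R_weight C u : C \in Q -> copy u true \in C -> weight C = 1 ->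
  #|R :&: neighbors G u| <= 1.
Proof.
move=> CQ uC <-; have uR := Q_copy CQ uC.
rewrite -(card_imset (f := dart u)); last by move=> t t' [].
apply/subset_leq_card/subsetP => _ /imsetP [t /setIP [tR +] ->].
rewrite inE => Gut.
rewrite !inE /= darts_R // ?andbT; last by rewrite G_sym.
apply: (comp_edge_mem gedge_sym (Q_odd CQ) uC); first exact: dart_free.
by rewrite gedge_copy_dart eqxx.
Qed.

Lemma copy_adjacent C u w : C \in Q -> copy u true \in C -> G u w ->
  w \notin S -> w \notin R -> copy w true \in C.
Proof.
move=> CQ uC Guw wS wR; have CO := Q_odd CQ; have uR := Q_copy CQ uC.
have Gwu : G w u by rewrite G_sym.
have duC : dart u w \in C.
  by apply: (comp_edge_mem gedge_sym CO uC (dart_free Guw uR)); rewrite /= eqxx.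
have dwC : dart w u \in C.
  by apply: (comp_edge_mem gedge_sym CO duC (dart_free Gwu wR)); rewrite gedge_dart.
by apply: (comp_edge_mem gedge_sym CO dwC (copy_free true wS)); rewrite /= eqxx.
Qed.

Lemma copy_in_notS C u : C \in Q -> copy u true \in C -> u \notin S.
Proof.
move=> CQ /(subsetP (odd_comps_sub (Q_odd CQ))).
by rewrite -/W in_free copies_S => /andP [].
Qed.

(** * The independent sets *)

Hypothesis hG : forall (I : {set T}) v, independent G I -> v \in I -> #|I| < degree G v.

(** A leaf corresponds to a component of G minus S and R that is reduced to the
    vertex u and joined to R by one edge. *)
Let leaf u := [exists C in Q, [&& weight C == 1, copy u true \in C &
   [forall v, (copy v true \in C) ==> (v == u)]]].

(** Every leaf has at most one neighbour in R, so trading these neighbours for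
    the leaves does not shrink R. As all its other neighbours are in S, a leaf u
    has degree at most |S| + 1 <= |R|, too small for such a set. *)
Lemma no_leaf u : ~~ leaf u.
Proof.
apply/negP => leafu; pose L := [set v | leaf v].
have leafP v : v \in L -> exists C, [/\ C \in Q, weight C = 1, copy v true \in C &
    forall v', copy v' true \in C -> v' = v].
  rewrite inE => /existsP [C /and4P [CQ /eqP w1 vC /forallP vU]].
  by exists C; split=> // v' v'C; apply/eqP; apply: (implyP (vU v')).
have LR v : v \in L -> v \notin R by case/leafP => C [CQ _ vC _]; apply: Q_copy CQ vC.
have LS v : v \in L -> v \notin S by case/leafP => C [CQ _ vC _]; apply: copy_in_notS CQ vC.
have Ldeg v : v \in L -> #|R :&: neighbors G v| <= 1.
  by case/leafP => C [CQ w1 vC _]; apply: neighbors_R_weight CQ vC w1.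
have Lnbr v w : v \in L -> G v w -> (w \in S) || (w \in R).
  case/leafP => C [CQ _ vC vU] Gvw; apply: contraT; rewrite negb_or => /andP [wS wR].
  have E := vU _ (copy_adjacent CQ vC Gvw wS wR).
  by rewrite E G_irr in Gvw.
pose N := \bigcup_(v in L) (R :&: neighbors G v).
have leN : #|N| <= #|L|.
  rewrite -[#|L|]sum1_card /N.
  apply: (@leq_trans (\sum_(v in L) #|R :&: neighbors G v|)); last exact: leq_sum.
  elim/big_rec2: _ => [|v n A _ leA]; first by rewrite cards0.
  by apply: leq_trans (leq_card_setU _ _) _; rewrite leq_add2l.
pose I := R :\: N :|: L.
have indI : independent G I.
  have RL t v : t \in R :\: N -> v \in L -> ~~ G t v.
    case/setDP => tR tN vL; apply: contra tN => Gtv; apply/bigcupP; exists v => //.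
    by rewrite !inE G_sym Gtv andbT in tR *.
  move=> t v /setUP [tI|tL] /setUP [vI|vL].
  - by move: tI vI => /setDP [tR _] /setDP [vR _]; apply: R_independent.
  - exact: RL.
  - by rewrite G_sym; apply: RL.
  - by apply/negP => /(Lnbr _ _ tL); rewrite (negPf (LS _ vL)) (negPf (LR _ vL)).
have uL : u \in L by rewrite inE.
have uI : u \in I by rewrite in_setU uL orbT.
have degu : degree G u <= #|S| + 1.
  rewrite /degree -(cardsID R (neighbors G u)) addnC setIC leq_add ?Ldeg //.
  apply/subset_leq_card/subsetP => w; rewrite !inE => /andP [wR Guw].
  by have := Lnbr _ _ uL Guw; rewrite !inE (negPf wR) orbF.
have cI : #|R| <= #|I|.
  have -> : #|I| = #|R :\: N| + #|L|.
    rewrite cardsU; suff -> : (R :\: N) :&: L = set0 by rewrite cards0 subn0.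
    apply/setP => t; rewrite !in_setI in_set0; apply/negP => /andP [/setDP [tR _] /LR].
    by rewrite tR.
  rewrite -(cardsID N R) addnC leq_add2l; apply: leq_trans leN.
  exact: subset_leq_card (subsetIr _ _).
have := hG indI uI; have := barrier_count; move: cI degu; card_lia.
Qed.

(** Since there is no leaf, a component in Q1 contains two vertices of G, and as
    its weight is 1 one of them has no neighbour in R. Adding one such vertex
    from each component to R keeps the set independent. *)
Lemma no_min_barrier : False.
Proof.
have cnt := barrier_count.
have [t0 t0R] : exists t, t \in R by apply/card_gt0P/(leq_ltn_trans _ cnt).
pose good (C : {set gvertex}) u := (copy u true \in C) && (R :&: neighbors G u == set0).
have goodP C : C \in Q1 -> exists u, good C u.
  rewrite inE => /and3P [CQ /eqP w1 /existsP [u uC]].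
  have [v [vC vu]] : exists v, copy v true \in C /\ v != u.
    have := no_leaf u; rewrite negb_exists => /forallP /(_ C).
    rewrite CQ w1 uC eqxx /= negb_forall => /existsP [v].
    by rewrite negb_imply => /andP [vC vu]; exists v.
  apply/existsP; apply: contraT; rewrite negb_exists => /forallP bad.
  (* If both u and v had neighbours in R, their darts would give weight 2. *)
  have dartC x : copy x true \in C ->
      exists t, dart x t \in C :&: [set y | flip y \in X].
    move=> xC; have := bad x; rewrite /good xC /= => /set0Pn [t /setIP [tR]].
    rewrite inE => Gxt; exists t; rewrite !inE /= darts_R // ?andbT; last by rewrite G_sym.
    apply: (comp_edge_mem gedge_sym (Q_odd CQ) xC).
      exact: dart_free Gxt (Q_copy CQ xC).
    by rewrite gedge_copy_dart eqxx.
  have [t ut] := dartC u uC; have [t' vt'] := dartC v vC.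
  move/eqP: w1 => /cards1P [y yE]; move: ut vt'; rewrite yE !inE => /eqP <- /eqP [E _].
  by rewrite E eqxx in vu.
pose g C := odflt t0 [pick u | good C u].
have gP C : C \in Q1 -> good C (g C).
  by move/goodP => [u gu]; rewrite /g; case: pickP => [//|/(_ u)]; rewrite gu.
have Q1Q C : C \in Q1 -> C \in Q by rewrite inE => /andP [].
have gC C : C \in Q1 -> copy (g C) true \in C by move/gP/andP => [].
have gR C t : C \in Q1 -> t \in R -> ~~ G (g C) t.
  move/gP/andP => [_ /eqP /setP /(_ t)]; rewrite in_set0 => E tR.
  by move: E; rewrite in_setI tR inE /= => ->.
have ginj : {in Q1 &, injective g}.
  move=> C D CQ DQ E; have CC := gC _ CQ; have DD := gC _ DQ.
  rewrite (odd_comps_eq gedge_sym (Q_odd (Q1Q _ CQ)) CC).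
  by rewrite (odd_comps_eq gedge_sym (Q_odd (Q1Q _ DQ)) DD) E.
pose I := R :|: g @: Q1.
have indI : independent G I.
  move=> t v /setUP [tR|/imsetP [C CQ ->]] /setUP [vR|/imsetP [D DQ ->]].
  - exact: R_independent.
  - by rewrite G_sym gR.
  - exact: gR.
  - apply/negP => Gg; have DD := gC _ DQ.
    have DC := copy_adjacent (Q1Q _ CQ) (gC _ CQ) Gg
      (copy_in_notS (Q1Q _ DQ) DD) (Q_copy (Q1Q _ DQ) DD).
    have E : C = D.
      by rewrite (odd_comps_eq gedge_sym (Q_odd (Q1Q _ CQ)) DC)
        [RHS](odd_comps_eq gedge_sym (Q_odd (Q1Q _ DQ)) DD).
    by rewrite E G_irr in Gg.
have cI : #|I| = #|R| + #|Q1|.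
  rewrite cardsU (card_in_imset ginj).
  suff -> : R :&: g @: Q1 = set0 by rewrite cards0 subn0.
  apply/setP => t; rewrite in_setI in_set0; apply/negP => /andP [tR /imsetP [C CQ E]].
  by have := Q_copy (Q1Q _ CQ) (gC _ CQ); rewrite -E tR.
have t0I : t0 \in I by rewrite in_setU t0R.
by have := hG indI t0I; have := degree_R t0R; move: cI cnt; card_lia.
Qed.

End MinBarrier.
End Gadget.

(** * Two-factors *)

Lemma min_degree_le (T : finType) (G : rel T) (I : {set T}) v :
  v \in I -> min_degree G I <= degree G v.
Proof.
move=> vI; rewrite /min_degree; have := mem_index_enum v.
elim: (index_enum T) => // w s IHs; rewrite inE big_cons.
case/orP => [/eqP <-|/IHs le_v]; first by rewrite vI geq_minl.
by case: ifP => // _; apply: leq_trans (geq_minr _ _) le_v.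
Qed.

Theorem theorem3 (T : finType) (G : rel T) (simpleG : simple_graph G)
  (hI : forall I : {set T}, I != set0 -> independent G I ->
          #|I| <= min_degree G I - 1) :
  exists H : rel T, two_factor G H.
Proof.
have [G_sym G_irr] := simpleG.
have hG (I : {set T}) v : independent G I -> v \in I -> #|I| < degree G v.
  move=> indI vI; have I0 : I != set0 by apply/set0Pn; exists v.
  have := hI I I0 indI; have : 0 < #|I| by rewrite card_gt0.
  have := min_degree_le G vI; card_lia.
have deg_gt0 v : 0 < degree G v.
  apply: leq_trans (hG [set v] v _ _) => //; last by rewrite inE.
  by move=> x y /set1P -> /set1P ->; rewrite G_irr.
have [|nW] := boolP (matchable (gedge G) (gvalid G)).
  exact: two_factor_of_matching.
have [X minX] := min_barrier_exists (gedge_sym G_sym) (gedge_irr G_irr) nW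
  (gvalid_even G_sym G_irr).
by case: (no_min_barrier G_sym G_irr minX deg_gt0 hG).
Qed.
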